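(* Let $r \ge 4$ and let $\mathcal{H}$ be an $r$-shift-chain. Then $\mathcal{H}$ is properly $2$-colourable; that is, there is a map $c: V(\mathcal{H}) \to \{1,2\}$ such that no edge of $\mathcal{H}$ is monochromatic under $c$.
   Context: For $n\in\mathbb{N}$ write $[n]=\{1,\ldots,n\}$ with its usual order. An $r$-shift-chain (a shift-chain of uniformity $r$) is an $r$-uniform hypergraph $\mathcal{H}$ on vertex set $[n]$ (for some $n$) such that for any two edges $\{e_1,\ldots,e_r\}$ and $\{f_1,\ldots,f_r\}$ of $\mathcal{H}$, written with $e_1<\cdots<e_r$ and $f_1<\cdots<f_r$, either $e_i\le f_i$ for all $i\in[r]$ or $f_i\le e_i$ for all $i\in[r]$. An edge is monochromatic under a colouring if all its vertices receive the same colour. *)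

(* Defs.v *)
From mathcomp Require Import all_boot.

Set Implicit Arguments.
Unset Strict Implicit.
Unset Printing Implicit Defensive.

(* The vertex set [n] = {1, ..., n} is represented by 'I_n = {0, ..., n - 1}
   with its usual order. *)
Definition hypergraph (n : nat) := {set {set 'I_n}}.

Definition uniform (n r : nat) (H : hypergraph n) : Prop :=
  forall e, e \in H -> #|e| = r.

(* [enum e] lists the vertices of an edge in increasing order. *)
Lemma sorted_enum_edge (n : nat) (e : {set 'I_n}) :
  sorted ltn [seq val x | x <- enum e].
Proof.
rewrite (@sorted_map _ _ val ltn) {1}/enum_mem.
apply: sorted_filter; first by move=> x y z; apply: ltn_trans.
by rewrite -enumT -(@sorted_map _ _ val ltn) val_enum_ord iota_ltn_sorted.
Qed.

(* e_i <= f_i for all i, where e_1 < ... < e_r and f_1 < ... < f_r. *)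
Definition edge_le (n : nat) (e f : {set 'I_n}) : bool :=
  all2 (fun x y : 'I_n => x <= y) (enum e) (enum f).

Definition shift_chain (n r : nat) (H : hypergraph n) : Prop :=
  uniform r H /\
  (forall e f, e \in H -> f \in H -> edge_le e f \/ edge_le f e).

Definition monochromatic (n k : nat) (c : 'I_n -> 'I_k) (e : {set 'I_n}) : Prop :=
  forall x y, x \in e -> y \in e -> c x = c y.

Definition properly_colourable (n k : nat) (H : hypergraph n) : Prop :=
  exists c : 'I_n -> 'I_k, forall e, e \in H -> ~ monochromatic c e.

(* Main.v *)
(** Only the first four vertices v_0 < v_1 < v_2 < v_3 of an edge matter.
    If all edges with v_3 < D have (v_0, v_1, v_2) <= (a, b, c), where
    a < b < c < D, then these edges can be properly coloured in such a way that
    [a, D) either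
    - changes colour exactly once, at a point of (a, c], or
    - has a free choice between changing colour once, right after c, and
      being constant except at the single point c.
    The induction goes from D back to c, with (v_0, v_1, v_2) of the greatest
    edge below c as the new bounds; in each case the colouring for c is continued
    by a constant from c or from c + 1 on.  The second alternative arises when
    the first one holds for c with a change at x, but some edge has v_1 < x and
    v_2 = c, so that neither constant colour on [c, D) is correct. *)
Require Import Defs.
From mathcomp Require Import all_boot.
From mathcomp Require Import zify.

Set Implicit Arguments.
Unset Strict Implicit.
Unset Printing Implicit Defensive.

(** Edges are abstract elements of [T], and [v i g] stands for vertex number [i] of [g], counted
    from 0; this frees the induction from sets and from [r]. *)
Definition quad_chain (T : finType) (H : {set T}) (v : nat -> T -> nat) : Prop :=
  {in H, forall g, [/\ v 0 g < v 1 g, v 1 g < v 2 g & v 2 g < v 3 g]} /\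
  {in H &, forall f g, (forall i, i < 4 -> v i f <= v i g) \/
                       (forall i, i < 4 -> v i g <= v i f)}.

Definition proper_below (T : finType) (H : {set T}) (v : nat -> T -> nat)
    (D : nat) (w : nat -> bool) : Prop :=
  forall g, g \in H -> v 3 g < D -> exists2 i, i < 4 & w (v i g) != w (v 0 g).

Definition constant_on (w : nat -> bool) (p q : nat) (k : bool) : Prop :=
  forall i, p <= i < q -> w i = k.

Definition one_change (T : finType) (H : {set T}) (v : nat -> T -> nat)
    (a c D : nat) : Prop :=
  exists x w k, [/\ a < x <= c, proper_below H v D w,
    constant_on w a x k & constant_on w x D (~~ k)].

Definition change_after_or_flip (T : finType) (H : {set T})
    (v : nat -> T -> nat) (a c D : nat) : Prop :=
  c.+1 < D /\ exists w1 w2 k,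
    [/\ proper_below H v D w1, constant_on w1 a c.+1 k
      & constant_on w1 c.+1 D (~~ k)] /\
    [/\ proper_below H v D w2, constant_on w2 a c k, w2 c = ~~ k
      & constant_on w2 c.+1 D k].

(** An edge below [c] with the largest sum of its four vertices works, as comparable edges are
    ordered like their sums. *)
Lemma greatest_edge_below (T : finType) (H : {set T}) (v : nat -> T -> nat)
    (c : nat) :
  quad_chain H v -> (exists2 g, g \in H & v 3 g < c) ->
  exists f, [/\ f \in H, v 3 f < c,
    forall g, g \in H -> v 3 g < c -> forall i, i < 4 -> v i g <= v i f
    & forall g, g \in H -> c <= v 3 g -> forall i, i < 4 -> v i f <= v i g].
Proof.
move=> [_ chainH] [g0 Hg0 lt_g0].
pose s g := v 0 g + v 1 g + v 2 g + v 3 g.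
pose P g := (g \in H) && (v 3 g < c).
have Pg0 : P g0 by rewrite /P Hg0.
case: (arg_maxnP s Pg0) => f /andP[Hf lt_f] max_f.
exists f; split=> // g Hg lt_g.
  have := max_f g; rewrite /P Hg lt_g => /(_ isT) le_s.
  case: (chainH g f Hg Hf) => // le_fg i lt_i.
  move: le_s (le_fg 0 isT) (le_fg 1 isT) (le_fg 2 isT) (le_fg 3 isT).
  rewrite /s; case: i lt_i => [|[|[|[|i]]]] //=; lia.
case: (chainH f g Hf Hg) => // le_gf; have := le_gf 3 isT; lia.
Qed.

(** The point [c] has its own colour [k], which differs from [l] only for [change_after_or_flip]. *)
Definition extend (w : nat -> bool) (c : nat) (k l : bool) : nat -> bool :=
  fun i => if i < c then w i else if i == c then k else l.

Lemma extend_lt w c k l i : i < c -> extend w c k l i = w i.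
Proof. by rewrite /extend => ->. Qed.

Lemma extend_eq w c k l : extend w c k l c = k.
Proof. by rewrite /extend ltnn eqxx. Qed.

Lemma extend_gt w c k l i : c < i -> extend w c k l i = l.
Proof. by move=> h; rewrite /extend ltnNge ltnW // gtn_eqF. Qed.

Lemma extend_ge w c k i : c <= i -> extend w c k k i = k.
Proof. by move=> h; rewrite /extend ltnNge h /= if_same. Qed.

Ltac solve_colour k := first [lia | by case: (k)].

(** An edge with [v 3 g < c] lies entirely where the extension agrees with [w]. *)
Lemma proper_extend (T : finType) (H : {set T}) (v : nat -> T -> nat)
    (c D : nat) (w : nat -> bool) (k l : bool) :
  quad_chain H v -> proper_below H v c w ->
  (forall g, g \in H -> v 3 g < D -> c <= v 3 g ->
     exists2 i, i < 4 & extend w c k l (v i g) != extend w c k l (v 0 g)) ->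
  proper_below H v D (extend w c k l).
Proof.
move=> [incr _] prop_w ge_c g Hg lt_g.
case: (ltnP (v 3 g) c) => [lt_gc | le_cg]; last exact: ge_c.
have [i lt_i neq_i] := prop_w g Hg lt_gc.
have [h0 h1 h2] := incr g Hg.
have lt_all j : j < 4 -> v j g < c by case: j => [|[|[|[|]]]] //=; lia.
by exists i => //; rewrite !extend_lt //; apply: lt_all.
Qed.

Lemma left_to_right_colouring (T : finType) (H : {set T}) (v : nat -> T -> nat)
    (a b c D : nat) :
  quad_chain H v -> a < b < c -> c < D ->
  (forall g, g \in H -> v 3 g < D -> [/\ v 0 g <= a, v 1 g <= b & v 2 g <= c]) ->
  one_change H v a c D \/ change_after_or_flip H v a c D.
Proof.
move=> QH; elim/ltn_ind: D a b c => D IH a b c /andP[ab bc] cD bound.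
have [incr chainH] := QH.
case: (boolP [exists g in H, v 3 g < c]) => [/exists_inP ex | /exists_inPn none].
  have [f [Hf lt_fc le_f ge_f]] := greatest_edge_below QH ex.
  have [f01 f12 f23] := incr f Hf.
  have [fa fb fc] := bound f Hf (ltn_trans lt_fc cD).
  (* Edges ending in [[c, D)] are squeezed between [f] and the bounds [a], [b], [c]. *)
  have facts g : g \in H -> v 3 g < D -> c <= v 3 g ->
      [/\ v 0 f <= v 0 g <= a, v 1 f <= v 1 g <= b & v 2 f <= v 2 g <= c] /\
      [/\ v 0 g < v 1 g, v 1 g < v 2 g & v 2 g < v 3 g].
    move=> Hg lt_g le_g; have [-> -> ->] := bound g Hg lt_g.
    by rewrite !ge_f //; split => //; apply: incr.
  have [||g Hg lt_g|[x [w [k [/andP[fx xf] prop_w wk wNk]]]]|] :=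
    IH c cD (v 0 f) (v 1 f) (v 2 f).
  - by rewrite f01.
  - exact: ltn_trans lt_fc.
  - by split; apply: le_f.
  - case: (ltnP a x) => [ax | xa].
      (* New edges start in [[v 0 f, a]], before [x], with colour [k] and end with [~~ k]. *)
      left; exists x, (extend w c (~~ k) (~~ k)), k; split.
      + lia.
      + apply: proper_extend => // g Hg lt_g le_g; exists 3 => //.
        have [[h0 h1 h2] _] := facts g Hg lt_g le_g.
        by rewrite extend_ge // extend_lt ?wk; solve_colour k.
      + by move=> i hi; rewrite extend_lt ?wk //; lia.
      + move=> i hi; case: (ltnP i c) => [ic | ci]; last by rewrite extend_ge.
        by rewrite extend_lt // wNk //; lia.
    case: (boolP [exists h in H, [&& v 3 h < D, v 1 h < x & v 2 h == c]]);
      last first.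
      move=> /exists_inPn no_jump; left.
      (* An edge starting before [x] meets [~~ k] at [v 1 g], or else at [v 2 g], which [no_jump]
         puts in [[x, c)]. Other new edges run from [~~ k] to [k]. *)
      exists c, (extend w c k k), (~~ k); split.
      + lia.
      + apply: proper_extend => // g Hg lt_g le_g.
        have [[h0 h1 h2] [g01 g12 g23]] := facts g Hg lt_g le_g.
        have {no_jump} := no_jump g Hg; rewrite lt_g /= => no_jump.
        case: (ltnP (v 0 g) x) => [g0x | xg0].
          case: (ltnP (v 1 g) x) => [g1x | xg1].
            exists 2 => //; rewrite !extend_lt ?(wNk (v 2 g)) ?(wk (v 0 g));
              solve_colour k.
          exists 1 => //; rewrite !extend_lt ?(wNk (v 1 g)) ?(wk (v 0 g));
            solve_colour k.
        exists 3 => //; rewrite extend_ge // extend_lt ?wNk;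
          solve_colour k.
      + by move=> i hi; rewrite extend_lt ?wNk //; lia.
      + by move=> i hi; rewrite extend_ge ?negbK //; lia.
    move=> /exists_inP[h Hh /and3P[lt_h h1x /eqP h2c]]; right.
    have [h01 h12 h23] := incr h Hh.
    split; first lia.
    exists (extend w c (~~ k) k), (extend w c k (~~ k)), (~~ k).
    split; split.
    (* If [v 0 g < x], the colour [~~ k] occurs at [v 2 g]. Otherwise [v 1 g > v 1 h] puts [g] above
       [h], so [v 3 g > c] has colour [k]. *)
    + apply: proper_extend => // g Hg lt_g le_g.
      have [[l0 l1 l2] [g01 g12 g23]] := facts g Hg lt_g le_g.
      case: (ltnP (v 0 g) x) => [g0x | xg0].
        exists 2 => //; rewrite [X in _ != X]extend_lt ?wk; try lia.
        case: (ltnP (v 2 g) c) => [g2c | cg2].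
          by rewrite extend_lt // wNk; solve_colour k.
        have -> : v 2 g = c by lia.
        by rewrite extend_eq; case: (k).
      exists 3 => //; rewrite [X in _ != X]extend_lt ?wNk; try lia.
      rewrite extend_gt; first by case: (k).
      by case: (chainH g h Hg Hh) => le_gh;
        move: (le_gh 1 isT) (le_gh 2 isT) (le_gh 3 isT); lia.
    + move=> i hi; case: (ltnP i c) => [ic | ci].
        by rewrite extend_lt // wNk //; lia.
      have -> : i = c by lia.
      exact: extend_eq.
    + by move=> i hi; rewrite extend_gt ?negbK //; lia.
    (* If [v 0 g < x], the colour [~~ k] occurs at [v 3 g], or at [v 2 g] when [v 3 g = c].
       Otherwise comparison with [h] forces [v 2 g = c], the flipped point. *)
    + apply: proper_extend => // g Hg lt_g le_g.
      have [[l0 l1 l2] [g01 g12 g23]] := facts g Hg lt_g le_g.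
      case: (ltnP (v 0 g) x) => [g0x | xg0].
        case: (ltnP c (v 3 g)) => [cg3 | g3c].
          exists 3 => //; rewrite extend_gt // extend_lt ?wk;
            solve_colour k.
        exists 2 => //; rewrite !extend_lt ?(wNk (v 2 g)) ?(wk (v 0 g));
          solve_colour k.
      exists 2 => //; rewrite [X in _ != X]extend_lt ?wNk; try lia.
      have -> : v 2 g = c.
        by case: (chainH g h Hg Hh) => le_gh;
          move: (le_gh 1 isT) (le_gh 2 isT); lia.
      by rewrite extend_eq; case: (k).
    + by move=> i hi; rewrite extend_lt // ?wNk //; lia.
    + by rewrite extend_eq negbK.
    + by move=> i hi; rewrite extend_gt //; lia.
  move=> [lt_f2c [w1 [w2 [k [[prop1 w1k w1Nk] [prop2 w2k w2f w2k']]]]]]; left.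
  case: (leqP a (v 2 f)) => [af | fa'].
    (* Since [a <= v 2 f], new edges start before the change of [w1]. *)
    exists (v 2 f).+1, (extend w1 c (~~ k) (~~ k)), k; split.
    + lia.
    + apply: proper_extend => // g Hg lt_g le_g; exists 3 => //.
      have [[l0 l1 l2] _] := facts g Hg lt_g le_g.
      by rewrite extend_ge // extend_lt ?w1k; solve_colour k.
    + by move=> i hi; rewrite extend_lt ?w1k //; lia.
    + move=> i hi; case: (ltnP i c) => [ic | ci]; last by rewrite extend_ge.
      by rewrite extend_lt // w1Nk //; lia.
  (* The flipped point [v 2 f] of [w2] is now left of [a]. An edge starting there has colour [k] at
     [v 1 g]; other new edges run from [k] to [~~ k]. *)
  exists c, (extend w2 c (~~ k) (~~ k)), k; split.
  + lia.
  + apply: proper_extend => // g Hg lt_g le_g.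
    have [[l0 l1 l2] [g01 g12 g23]] := facts g Hg lt_g le_g.
    case: (ltngtP (v 0 g) (v 2 f)) => [lt_g0 | gt_g0 | eq_g0].
    * exists 3 => //; rewrite extend_ge // extend_lt ?w2k;
        solve_colour k.
    * exists 3 => //; rewrite extend_ge // extend_lt ?w2k';
        solve_colour k.
    * exists 1 => //; rewrite !extend_lt ?eq_g0 ?w2f ?(w2k' (v 1 g));
        solve_colour k.
  + by move=> i hi; rewrite extend_lt ?w2k' //; lia.
  + by move=> i hi; rewrite extend_ge //; lia.
(* No edge ends before [c], so each edge in question starts before [c] and ends at or after it. *)
left; exists c, (fun i => c <= i), false; split.
- lia.
- move=> g Hg lt_g; exists 3 => //.
  have [l0 l1 l2] := bound g Hg lt_g; have := none g Hg; lia.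
- by move=> i hi; lia.
- by move=> i hi; lia.
Qed.

Lemma quad_chain_proper_colouring (T : finType) (H : {set T})
    (v : nat -> T -> nat) (n : nat) :
  quad_chain H v -> {in H, forall g, v 3 g < n} ->
  exists w : nat -> bool, {in H, forall g, exists2 i, i < 4 & w (v i g) != w (v 0 g)}.
Proof.
move=> QH ltn_v; have [incr _] := QH.
(* Bounds of at least [n] hold for all edges, and either alternative supplies a colouring. *)
have [||g Hg _|[x [w [k [_ prop_w _ _]]]]|[_ [w [_ [_ [[prop_w _ _] _]]]]]] :=
  @left_to_right_colouring T H v n n.+1 n.+2 n.+3 QH.
- lia.
- lia.
- by have [h0 h1 h2] := incr g Hg; have := ltn_v g Hg; split; lia.
- by exists w => g Hg; apply: prop_w => //; have := ltn_v g Hg; lia.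
- by exists w => g Hg; apply: prop_w => //; have := ltn_v g Hg; lia.
Qed.

Lemma edge_leP (n : nat) (e f : {set 'I_n}) (i : nat) :
  edge_le e f -> i < #|e| ->
  nth 0 [seq val x | x <- enum e] i <= nth 0 [seq val x | x <- enum f] i.
Proof.
rewrite /edge_le cardE; elim: (enum e) (enum f) i => [|x s IHs] [|y t] [|i] //=.
  by case/andP.
by case/andP=> _ /IHs h /h.
Qed.

Theorem theorem1p2 (r n : nat) (H : hypergraph n)
  (hr : 4 <= r) (hH : shift_chain r H) : properly_colourable 2 H.
Proof.
have [unif chainH] := hH.
(* The default [0] is never read for edges of [H], since only [i < 4 <= r] occurs. *)
pose v i (e : {set 'I_n}) := nth 0 [seq val x | x <- enum e] i.
have vP e i : e \in H -> i < 4 -> exists2 x, x \in e & v i e = val x.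
  move=> He lt_i; have lt_ie : i < size [seq val x | x <- enum e].
    by rewrite size_map -cardE unif // (leq_trans lt_i).
  by have /mapP[x] := mem_nth 0 lt_ie; rewrite mem_enum; exists x.
have incr e i : e \in H -> i < 3 -> v i e < v i.+1 e.
  move=> He lt_i; apply: (sorted_ltn_nth ltn_trans) => //.
  - exact: sorted_enum_edge.
  - by rewrite inE size_map -cardE unif //; lia.
  - by rewrite inE size_map -cardE unif //; lia.
have QH : quad_chain H v.
  split=> [e He | e f He Hf]; first by split; apply: incr.
  case: (chainH e f He Hf) => le_ef; [left | right] => i lt_i;
    by apply: edge_leP => //; rewrite unif //; apply: leq_trans hr.
have [|w wP] := @quad_chain_proper_colouring _ H v n QH.
  by move=> e He; have [x _ ->] := vP e 3 He isT; apply: ltn_ord.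
exists (fun x => inord (w x)) => e He mono.
have [i lt_i] := wP e He.
have [x ex ->] := vP e i He lt_i; have [y ey ->] := vP e 0 He isT.
have := mono x y ex ey => /(congr1 val); rewrite /= !inordK ?ltnS ?leq_b1 //.
by case: (w x) (w y) => [] [].
Qed.
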